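(* Let $(V,\rhd)$ be a magma algebra over $\mathbf k$. The $K$-map $K:\mathsf T(V)_\rhd\to\mathsf T(V)$ is given by $$K(x_1\cdots x_n)=\sum_\pi(-1)^{n-|\pi|}\,x^{\blacktriangleright}_{B_1}\cdots x^{\blacktriangleright}_{B_{|\pi|}},\qquad\forall\,x_1,\dots,x_n\in V,$$ where the sum ranges over all set partitions $\pi=(B_1,\dots,B_{|\pi|})$ of $[n]=\{1,\dots,n\}$ into (nonempty) blocks, indexed so that $\max B_1<\cdots<\max B_{|\pi|}$, and for $I=\{i_1<\cdots<i_r\}\subseteq[n]$ $$x^{\blacktriangleright}_I:=x_{i_1}\cdots x_{i_{r-1}}\blacktriangleright x_{i_r}=\sum_{w\in S_{r-1}}[x_{i_1},\dots,x_{i_{r-1}};x_{i_r}]_w\in V,$$ with the convention $x^{\blacktriangleright}_{\{i\}}=x_i$ for all $i\in[n]$.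
   Context: $\mathbf k$ is an algebraically closed field of characteristic $0$. A magma algebra $(V,\rhd)$ is a vector space with a bilinear product $\rhd:V\otimes V\to V$. $\mathsf T(V)$ is the tensor algebra; elements of $V$ are called letters, pure tensors are written as words $x_1\cdots x_m$ (tensor signs omitted), and $|X|$ is the number of letters of a word $X$. $\mathsf T(V)$ carries the concatenation product, the coshuffle coproduct $\Delta_{\sqcup\!\sqcup}$ (the algebra map with $\Delta_{\sqcup\!\sqcup}(x)=x\otimes1+1\otimes x$ for $x\in V$; Sweedler notation $X_1\otimes X_2$, iterated coproduct $\Delta_{\sqcup\!\sqcup}^{(m-1)}(X)=X_1\otimes\cdots\otimes X_m$), its counit $\varepsilon$, and the antipode $S(x_1\cdots x_m)=(-1)^mx_m\cdots x_1$. The product $\rhd$ is extended to $\mathsf T(V)$ by: $1\rhd a=a$; $(xx_1\cdots x_n)\rhd a=x\rhd\big((x_1\cdots x_n)\rhd a\big)-\sum_{i=1}^n\big(x_1\cdots x_{i-1}(x\rhd x_i)x_{i+1}\cdots x_n\big)\rhd a$; $X\rhd1=\varepsilon(X)1$; $X\rhd(a_1\cdots a_k)=(X_1\rhd a_1)\cdots(X_k\rhd a_k)$, for $x,x_i,a,a_i\in V$, $X\in\mathsf T(V)$. With $X\circ Y=X_1\,(X_2\rhd Y)$, $\mathsf T(V)_\rhd=(\mathsf T(V),\circ,1,\Delta_{\sqcup\!\sqcup},\varepsilon,S_\rhd)$ is a Hopf algebra (known), with antipode denoted $S_\rhd$. The bilinear product $\blacktriangleright$ on $\mathsf T(V)$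 is defined by $X\blacktriangleright Y:=(-1)^{|X|}S_\rhd(X)\rhd Y$ for words $X,Y$. The $K$-map is the Hopf algebra isomorphism $K:\mathsf T(V)_\rhd\to\mathsf T(V)$ (target with concatenation product) recursively determined by $K(1)=1$, $K(x)=x$ and $K(x_1\cdots x_n)=x_1K(x_2\cdots x_n)-\sum_{i=2}^nK\big(x_2\cdots x_{i-1}(x_1\rhd x_i)x_{i+1}\cdots x_n\big)$ for $x,x_1,\dots,x_n\in V$. Definition of $[x_1,\dots,x_m;Y]_w\in\mathsf T(V)$ for letters $x_1,\dots,x_m\in V$, a word $Y\in\mathsf T(V)$ and $w\in S_m$: start with the sequence $x_{w(1)},x_{w(2)},\dots,x_{w(m)},Y$. For $k=1,2,\dots,m$ successively, take the entry of the current sequence which involves $x_k$ (treating $x_1,\dots,x_m$ as formal symbols), call it $A$, and let $C$ be the entry immediately to its right; replace the two adjacent entries $A,C$ by the single entry $A\rhd C$. After $m$ steps one entry remains, and it is $[x_1,\dots,x_m;Y]_w$. For example, $[x_1,\dots,x_6;Y]_{256314}=((x_2\rhd x_5)\rhd x_6)\rhd((x_3\rhd(x_1\rhd x_4))\rhd Y)$ (with $w$ in one-line notation). *)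

(* Defs.v *)
From HB Require Import structures.
From mathcomp Require Import all_boot all_order all_fingroup all_algebra.
From mathcomp Require Import boolp classical_sets.

Set Implicit Arguments.
Unset Strict Implicit.
Unset Printing Implicit Defensive.

Import GRing.Theory.
Local Open Scope ring_scope.

(* The universal properties.  [letter] embeds V in T(V) and [tens A B] is the
   pure tensor A (x) B. *)

Definition is_tensor_algebra (k : fieldType) (V : lmodType k) (T : algType k)
    (letter : {linear V -> T}) : Prop :=
  forall (A : algType k) (f : {linear V -> A}),
    (exists g : {lrmorphism T -> A}, forall v, g (letter v) = f v) /\
    (forall g h : {lrmorphism T -> A},
       (forall v, g (letter v) = h (letter v)) -> forall X, g X = h X).

Definition is_tensor_product (k : fieldType) (U W P : lmodType k)
    (tens : {bilinear U -> W -> P}) : Prop :=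
  forall (M : lmodType k) (b : {bilinear U -> W -> M}),
    (exists g : {linear P -> M}, forall u w, g (tens u w) = b u w) /\
    (forall g h : {linear P -> M},
       (forall u w, g (tens u w) = h (tens u w)) -> forall t, g t = h t).

Definition is_tensor_square_algebra (k : fieldType) (T TT : algType k)
    (tens : {bilinear T -> T -> TT}) : Prop :=
  [/\ is_tensor_product tens,
      tens 1 1 = 1 &
      forall A B C D : T, tens A B * tens C D = tens (A * C) (B * D)].

Definition word (k : fieldType) (V : lmodType k) (T : algType k)
    (letter : {linear V -> T}) (X : seq V) : T :=
  \prod_(x <- X) letter x.

Definition is_coshuffle (k : fieldType) (V : lmodType k) (T TT : algType k)
    (letter : {linear V -> T}) (tens : {bilinear T -> T -> TT})
    (Delta : {lrmorphism T -> TT}) : Prop :=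
  forall x : V, Delta (letter x) = tens (letter x) 1 + tens 1 (letter x).

(* Sweedler notation.  [sw_terms tens Delta X] is some list of pairs
   (A_i, B_i) with Delta X = \sum_i A_i (x) B_i.  It is only used in sums of
   expressions that are bilinear in (A_i, B_i), whose value does not depend on
   the chosen list. *)
Definition sw_terms (k : fieldType) (T TT : algType k)
    (tens : {bilinear T -> T -> TT}) (Delta : {lrmorphism T -> TT})
    (X : T) : seq (T * T) :=
  xget [::] (fun s : seq (T * T) => Delta X = \sum_(p <- s) tens p.1 p.2).

(* Iterated coproduct: a list of sequences [:: X_1; ...; X_(m.+1)] whose pure
   tensors add up to Delta^(m) X, where Delta^(m) = (id (x) Delta^(m-1)) o Delta. *)
Fixpoint sw_iter (k : fieldType) (T TT : algType k)
    (tens : {bilinear T -> T -> TT}) (Delta : {lrmorphism T -> TT})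
    (m : nat) (X : T) : seq (seq T) :=
  if m is m'.+1 then
    [seq p.1 :: q | p <- sw_terms tens Delta X,
                    q <- sw_iter tens Delta m' p.2]
  else [:: [:: X]].

Definition is_counit (k : fieldType) (T TT : algType k)
    (tens : {bilinear T -> T -> TT}) (Delta : {lrmorphism T -> TT})
    (eps : {scalar T}) : Prop :=
  forall X : T,
    \sum_(p <- sw_terms tens Delta X) eps p.1 *: p.2 = X /\
    \sum_(p <- sw_terms tens Delta X) eps p.2 *: p.1 = X.

(* x_1 ... x_(i-1) (x |> x_i) x_(i+1) ... x_n, positions counted from 0 *)
Definition act_at (k : fieldType) (V : lmodType k)
    (tri : {bilinear V -> V -> V}) (x : V) (X : seq V) (i : nat) : seq V :=
  set_nth 0 X i (tri x (nth 0 X i)).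

(* The extension [ext] of the magma product [tri] to T(V). *)
Definition is_extension (k : fieldType) (V : lmodType k) (T TT : algType k)
    (letter : {linear V -> T}) (tens : {bilinear T -> T -> TT})
    (Delta : {lrmorphism T -> TT}) (eps : {scalar T})
    (tri : {bilinear V -> V -> V}) (ext : {bilinear T -> T -> T}) : Prop :=
  [/\ forall x a : V, ext (letter x) (letter a) = letter (tri x a),
      forall a : V, ext 1 (letter a) = letter a,
      forall (x : V) (X : seq V) (a : V),
        ext (word letter (x :: X)) (letter a) =
        ext (letter x) (ext (word letter X) (letter a))
        - \sum_(i < size X) ext (word letter (act_at tri x X i)) (letter a),
      forall X : T, ext X 1 = eps X *: 1 &
      forall (X : T) (a : V) (Y : seq V),
        ext X (word letter (a :: Y)) =
        \sum_(q <- sw_iter tens Delta (size Y) X)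
          \prod_(p <- zip q (a :: Y)) ext p.1 (letter p.2)].

Definition circ (k : fieldType) (T TT : algType k)
    (tens : {bilinear T -> T -> TT}) (Delta : {lrmorphism T -> TT})
    (ext : {bilinear T -> T -> T}) (X Y : T) : T :=
  \sum_(p <- sw_terms tens Delta X) p.1 * ext p.2 Y.

(* The antipode of (T(V), circ, 1, Delta, eps). *)
Definition is_antipode (k : fieldType) (T TT : algType k)
    (tens : {bilinear T -> T -> TT}) (Delta : {lrmorphism T -> TT})
    (eps : {scalar T}) (ext : {bilinear T -> T -> T})
    (S : {linear T -> T}) : Prop :=
  forall X : T,
    \sum_(p <- sw_terms tens Delta X) circ tens Delta ext (S p.1) p.2
      = eps X *: 1 /\
    \sum_(p <- sw_terms tens Delta X) circ tens Delta ext p.1 (S p.2)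
      = eps X *: 1.

(* Since words span T(V), these equations determine the bilinear map. *)
Definition is_black (k : fieldType) (V : lmodType k) (T : algType k)
    (letter : {linear V -> T}) (ext : {bilinear T -> T -> T})
    (S : {linear T -> T}) (black : {bilinear T -> T -> T}) : Prop :=
  forall X Y : seq V,
    black (word letter X) (word letter Y) =
    (-1) ^+ size X *: ext (S (word letter X)) (word letter Y).

(* Since words span T(V), these equations determine the linear map K; that K is
   a Hopf algebra isomorphism is a consequence, not part of the definition. *)
Definition is_Kmap (k : fieldType) (V : lmodType k) (T : algType k)
    (letter : {linear V -> T}) (tri : {bilinear V -> V -> V})
    (K : {linear T -> T}) : Prop :=
  [/\ K 1 = 1,
      forall x : V, K (letter x) = letter x &
      forall (x : V) (X : seq V),
        K (word letter (x :: X)) =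
        letter x * K (word letter X)
        - \sum_(i < size X) K (word letter (act_at tri x X i))].

(* [x_1, ..., x_m; Y]_w.  An entry is a pair (labels, value), where the first
   component lists the indices of the formal symbols involved in the entry.
   The symbols are numbered from 0, and the entry Y carries no label. *)

Fixpoint merge_at (E : Type) (op : E -> E -> E) (j : nat)
    (s : seq (seq nat * E)) : seq (seq nat * E) :=
  if s is A :: t then
    if t is C :: u then
      if j \in A.1 then (A.1 ++ C.1, op A.2 C.2) :: u
      else A :: merge_at op j t
    else [:: A]
  else [::].

Definition bracket_from (E : Type) (op : E -> E -> E) (X : seq E) (Y : E)
    (w : seq nat) : E :=
  let start := rcons [seq ([:: j], nth Y X j) | j <- w] ([::], Y) in
  (head ([::], Y) (foldl (fun s j => merge_at op j s) start
                         (iota 0 (size X)))).2.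

Definition bracket (E : Type) (op : E -> E -> E) (X : seq E) (Y : E)
    (w : 'S_(size X)) : E :=
  bracket_from op X Y [seq val (w j) | j <- enum 'I_(size X)].

(* The letters indexed by I = {i_1 < ... < i_r} are split into the word
   x_(i_1) ... x_(i_(r-1)) and the last letter x_(i_r). *)

Definition letters (k : fieldType) (V : lmodType k) (n : nat)
    (x : 'I_n -> V) (I : {set 'I_n}) : seq V :=
  [seq x i | i <- enum I].

Definition init_letters (k : fieldType) (V : lmodType k) (n : nat)
    (x : 'I_n -> V) (I : {set 'I_n}) : seq V :=
  take #|I|.-1 (letters x I).

Definition last_letter (k : fieldType) (V : lmodType k) (n : nat)
    (x : 'I_n -> V) (I : {set 'I_n}) : V :=
  last 0 (letters x I).

Definition xblack (k : fieldType) (V : lmodType k) (T : algType k)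
    (letter : {linear V -> T}) (black : {bilinear T -> T -> T}) (n : nat)
    (x : 'I_n -> V) (I : {set 'I_n}) : T :=
  black (word letter (init_letters x I)) (letter (last_letter x I)).

Definition sorted_blocks (n : nat) (P : {set {set 'I_n}}) :
    seq {set 'I_n} :=
  sort (fun B C : {set 'I_n} =>
          (\max_(i in B) val i <= \max_(i in C) val i)%N) (enum P).

(* Main.v *)
(* On letters the action of T(V) satisfies (X o Y) |> a = X |> (Y |> a), so that
   X |-> (S X |> _) is the convolution inverse of X |-> (X |> _).  The recursion
   for (x X) |> a then turns into
     (x X) black a = X black (x |> a) + sum over i of X_i black a,
   where X_i is X with its i-th letter y replaced by x |> y.  The sum of the
   brackets [x X; a]_w obeys the same recursion: the first step merges x with its
   right neighbour, which is either a or a letter of X.  Similarly, in the sum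
   over set partitions the first letter x is either a block of its own, which
   yields x K(X), or it belongs to a larger block x B, and
   (x B)^black is the sum of the B_i^black, which yields - sum of K(X_i). *)
Require Import Defs.
From HB Require Import structures.
From mathcomp Require Import all_boot all_order all_fingroup all_algebra.
From mathcomp Require boolp classical_sets.

Set Implicit Arguments.
Unset Strict Implicit.
Unset Printing Implicit Defensive.

Import GRing.Theory.
Local Open Scope ring_scope.

(** * The span of the words *)

Section WordSpan.
Context (k : fieldType) (V : lmodType k) (T : algType k).
Variable letter : {linear V -> T}.

Lemma word_nil : word letter [::] = 1.
Proof. by rewrite /word big_nil. Qed.

Lemma word_cons x X : word letter (x :: X) = letter x * word letter X.
Proof. by rewrite /word big_cons. Qed.

Lemma word_cat X Y : word letter (X ++ Y) = word letter X * word letter Y.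
Proof. by rewrite /word big_cat. Qed.

Lemma word1 x : word letter [:: x] = letter x.
Proof. by rewrite /word big_seq1. Qed.

Definition wcomb (s : seq (k * seq V)) : T :=
  \sum_(p <- s) p.1 *: word letter p.2.

(** The existential is reflected classically into a boolean, the form in which a subalgebra has to
    be presented. *)
Definition in_words : {pred T} := fun X => boolp.asbool (exists s, X = wcomb s).

Lemma in_wordsP X : reflect (exists s, X = wcomb s) (X \in in_words).
Proof. exact: boolp.asboolP. Qed.

Lemma in_words_closed : GRing.subsemialg_closed in_words.
Proof.
split.
- by apply/in_wordsP; exists [:: (1, [::])]; rewrite /wcomb big_seq1 scale1r word_nil.
- split; first by apply/in_wordsP; exists [::]; rewrite /wcomb big_nil.
  move=> _ _ /in_wordsP[s ->] /in_wordsP[t ->]; apply/in_wordsP.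
  by exists (s ++ t); rewrite /wcomb big_cat.
- move=> c _ /in_wordsP[s ->]; apply/in_wordsP.
  exists [seq (c * p.1, p.2) | p <- s]; rewrite /wcomb big_map scaler_sumr.
  by apply: eq_bigr => p _; rewrite scalerA.
- move=> _ _ /in_wordsP[s ->] /in_wordsP[t ->]; apply/in_wordsP.
  exists [seq (p.1 * q.1, p.2 ++ q.2) | p <- s, q <- t].
  rewrite /wcomb big_allpairs_dep mulr_suml; apply: eq_bigr => p _.
  rewrite mulr_sumr; apply: eq_bigr => q _ /=.
  by rewrite word_cat -scalerAl -scalerAr scalerA.
Qed.

Lemma letter_in_words v : letter v \in in_words.
Proof.
by apply/in_wordsP; exists [:: (1, [:: v])]; rewrite /wcomb big_seq1 scale1r word1.
Qed.

(** The span of the words becomes an algebra in its own right, a possible target for the universal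
    property. *)
Record wordT := WordT { wordT_val :> T; _ : wordT_val \in in_words }.
HB.instance Definition _ := [isSub for wordT_val].
HB.instance Definition _ := [Choice of wordT by <:].
HB.instance Definition _ :=
  GRing.SubChoice_isSubAlgebra.Build k T in_words wordT in_words_closed.

Definition wletter v := WordT (letter_in_words v).
Lemma wletter_linear : linear wletter.
Proof. by move=> c u v; apply: val_inj; rewrite /= linearP. Qed.
HB.instance Definition _ :=
  GRing.isLinear.Build k V wordT _ wletter wletter_linear.

Definition unword (X : wordT) : T := val X.
HB.instance Definition _ := GRing.RMorphism.copy unword (val : wordT -> T).
HB.instance Definition _ := GRing.Linear.copy unword (val : wordT -> T).

(* By the universal property, the inclusion of the subalgebra spanned by the
   words has a section. *)
Lemma words_span (hT : is_tensor_algebra letter) (X : T) :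
  exists s : seq (k * seq V), X = \sum_(p <- s) p.1 *: word letter p.2.
Proof.
have [[g gE] _] := hT wordT wletter.
have [_ uT] := hT T letter.
pose h : {lrmorphism T -> T} := unword \o g.
have -> : X = h X.
  by apply: (uT idfun) => v /=; rewrite gE.
by apply/in_wordsP; apply: (valP (g X)).
Qed.
End WordSpan.

(** * Splittings of words and Sweedler sums *)

Section SplitsActs.
Variable A : Type.

(** These are the terms of the coshuffle coproduct of a word: a subword paired with its
    complement. *)
Fixpoint splits (X : seq A) : seq (seq A * seq A) :=
  if X is x :: X' then
    [seq (x :: p.1, p.2) | p <- splits X'] ++ [seq (p.1, x :: p.2) | p <- splits X']
  else [:: ([::], [::])].

Variable f : A -> A.

(** This structurally recursive form of [act_at] also serves for lists of blocks, with [f] adding a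
    letter to a block. *)
Fixpoint acts (X : seq A) : seq (seq A) :=
  if X is y :: X' then (f y :: X') :: [seq y :: Z | Z <- acts X'] else [::].

Lemma all_size_acts X : all (fun Z => size Z == size X) (acts X).
Proof.
elim: X => //= y X IH; rewrite eqxx /= all_map.
by apply: sub_all IH => Z /=; rewrite eqSS.
Qed.

(** It isolates the term X (x) 1, the one not covered by an induction on the length of the left
    factor. *)
Lemma splits_full X : exists2 r, splits X = (X, [::]) :: r
  & all (fun p => size p.1 < size X)%N r.
Proof.
elim: X => [|x X [r Er rP]] /=; first by exists [::].
rewrite Er; exists ([seq (x :: p.1, p.2) | p <- r]
        ++ (X, [:: x]) :: [seq (p.1, x :: p.2) | p <- r]) => //.
rewrite all_cat /= ltnSn !all_map; apply/andP; split=> //.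
by apply: sub_all rP => p /= /ltnW.
Qed.

Variable M : zmodType.

Lemma big_splits_cons x X (F : seq A * seq A -> M) :
  \sum_(p <- splits (x :: X)) F p =
  \sum_(p <- splits X) (F (x :: p.1, p.2) + F (p.1, x :: p.2)).
Proof. by rewrite /= big_cat !big_map big_split. Qed.

Lemma big_acts_cons y X (F : seq A -> M) :
  \sum_(Z <- acts (y :: X)) F Z =
  F (f y :: X) + \sum_(Z <- acts X) F (y :: Z).
Proof. by rewrite /= big_cons big_map. Qed.

(* Replacing one letter by its image under f is a coderivation for the coshuffle
   coproduct. *)
Lemma splits_acts X (F : seq A -> seq A -> M) :
  \sum_(Z <- acts X) \sum_(p <- splits Z) F p.1 p.2 =
  \sum_(p <- splits X) (\sum_(Z <- acts p.1) F Z p.2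
                        + \sum_(Z <- acts p.2) F p.1 Z).
Proof.
elim: X F => [|y X IH] F; first by rewrite /= big_seq1 /= !big_nil addr0.
rewrite big_acts_cons !big_splits_cons.
under [X in _ + X]eq_bigr => Z _ do rewrite big_splits_cons big_split /=.
have /= E1 := IH (fun Y Z => F (y :: Y) Z).
have /= E2 := IH (fun Y Z => F Y (y :: Z)).
rewrite [X in _ + X]big_split /= E1 E2.
rewrite -!big_split /=; apply: eq_bigr => p _; rewrite !big_cons !big_map.
exact: (AC (2*(2*2)) ((1*3*4)*(5*(2*6)))).
Qed.

Lemma sum_set_nth d X (F : seq A -> M) :
  \sum_(i < size X) F (set_nth d X i (f (nth d X i)))
  = \sum_(Z <- acts X) F Z.
Proof.
elim: X F => [|y X IH] F; first by rewrite big_ord0 big_nil.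
by rewrite big_acts_cons big_ord_recl -(IH (fun Z => F (y :: Z))).
Qed.

End SplitsActs.

(** * The coproduct of a word and the evaluation of Sweedler sums *)

Section Sweedler.
Context (k : fieldType) (V : lmodType k) (T TT : algType k).
Variables (letter : {linear V -> T}) (tens : {bilinear T -> T -> TT}).
Variable Delta : {lrmorphism T -> TT}.
Hypothesis hT : is_tensor_algebra letter.
Hypothesis hTT : is_tensor_square_algebra tens.
Hypothesis hDelta : is_coshuffle letter tens Delta.
Local Notation W := (word letter).

(** Words span. Plain functions with linearity proofs are accepted, so that compound expressions
    need not be bundled. *)
Lemma eq_on_words (M : lmodType k) (f g : T -> M) :
  linear f -> linear g -> (forall X, f (W X) = g (W X)) -> f =1 g.
Proof.
move=> lf lg fg X; have [s ->] := words_span hT X.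
pose F : {linear T -> M} := HB.pack f (GRing.isLinear.Build _ _ _ _ f lf).
pose G : {linear T -> M} := HB.pack g (GRing.isLinear.Build _ _ _ _ g lg).
rewrite -[f]/(F : _ -> _) -[g]/(G : _ -> _) !linear_sum.
by apply: eq_bigr => p _; rewrite !linearZ /= fg.
Qed.

Lemma Delta_word X : Delta (W X) = \sum_(p <- splits X) tens (W p.1) (W p.2).
Proof.
have [_ t1 tM] := hTT.
elim: X => [|x X IH]; first by rewrite /= big_seq1 /= !word_nil t1 rmorph1.
rewrite big_splits_cons word_cons rmorphM /=.
rewrite IH hDelta mulr_sumr.
apply: eq_bigr => p _ /=.
by rewrite mulrDl !tM !mul1r !word_cons.
Qed.

(** A decomposition into pure tensors exists, by expanding X in words, so the default [[::]] in
    [sw_terms] is never taken. *)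
Lemma sw_termsP X : Delta X = \sum_(p <- sw_terms tens Delta X) tens p.1 p.2.
Proof.
suff [s Es] : exists s, Delta X = \sum_(p <- s) tens p.1 p.2.
  by rewrite {1}Es /sw_terms; case: classical_sets.xgetP => [t _ <-|/(_ s)//].
have [s ->] := words_span hT X.
exists (flatten [seq [seq (q.1 *: W p.1, W p.2) | p <- splits q.2] | q <- s]).
rewrite big_flatten big_map linear_sum; apply: eq_bigr => q _.
rewrite linearZ /= Delta_word big_map scaler_sumr.
by apply: eq_bigr => p _; rewrite linearZl_LR.
Qed.

(** By the universal property of the tensor product, a bilinear Sweedler sum depends on [Delta X]
    only, not on the chosen list. *)
Lemma sw_factor (M : lmodType k) (f : T -> T -> M) :
  bilinear_for *:%R *:%R f ->
  exists g : {linear TT -> M}, (forall u w, g (tens u w) = f u w) /\ forall X,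
    \sum_(p <- sw_terms tens Delta X) f p.1 p.2 = g (Delta X).
Proof.
move=> bf; have [hP _ _] := hTT.
pose F : {bilinear T -> T -> M} :=
  HB.pack f (bilinear_isBilinear.Build _ _ _ _ _ _ f bf).
have [[g gE] _] := hP _ F; exists g; split=> // X.
by rewrite sw_termsP linear_sum; apply: eq_bigr => p _; rewrite gE.
Qed.

Lemma sw_word (M : lmodType k) (f : T -> T -> M) X :
  bilinear_for *:%R *:%R f ->
  \sum_(p <- sw_terms tens Delta (W X)) f p.1 p.2
  = \sum_(p <- splits X) f (W p.1) (W p.2).
Proof.
move=> /sw_factor[g [gE ->]]; rewrite Delta_word linear_sum.
by apply: eq_bigr => p _; rewrite gE.
Qed.

Lemma sw_linear (M : lmodType k) (f : T -> T -> M) :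
  bilinear_for *:%R *:%R f ->
  linear (fun X => \sum_(p <- sw_terms tens Delta X) f p.1 p.2).
Proof. by move=> /sw_factor[g [_ gE]] c X Y; rewrite !gE !linearP. Qed.

End Sweedler.

(** * The action of T(V) and the antipode *)

Section PostHopf.
Context (k : fieldType) (V : lmodType k) (T TT : algType k).
Variables (letter : {linear V -> T}) (tens : {bilinear T -> T -> TT}).
Variables (Delta : {lrmorphism T -> TT}) (eps : {scalar T}).
Variables (tri : {bilinear V -> V -> V}) (ext : {bilinear T -> T -> T}).
Hypothesis hT : is_tensor_algebra letter.
Hypothesis hTT : is_tensor_square_algebra tens.
Hypothesis hDelta : is_coshuffle letter tens Delta.
Hypothesis heps : is_counit tens Delta eps.
Hypothesis hext : is_extension letter tens Delta eps tri ext.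
Local Notation W := (word letter).
Local Notation circ := (circ tens Delta ext).

Lemma sum_splits_nil (M : lmodType k) X (F : seq V -> M) :
  \sum_(p <- splits X) (nilp p.1)%:R *: F p.2 = F X.
Proof.
elim: X F => [|x X IH] F; first by rewrite /= big_seq1 scale1r.
rewrite big_splits_cons -(IH (fun Y => F (x :: Y))).
by apply: eq_bigr => p _ /=; rewrite scale0r add0r.
Qed.

Let sw_wordT := sw_word hT hTT hDelta.

(** Both [eps] and the indicator of the empty word satisfy the left counit identity. In the
    difference of the two identities all terms with a shorter left factor cancel by induction, and
    only the multiple of 1 from the full split remains. *)
Lemma eps_word X : eps (W X) = (nilp X)%:R.
Proof.
have [n] := ubnP (size X); elim: n X => // n IH X /ltnSE leXn.
have := (heps (W X)).1; rewrite (sw_wordT (f := fun A B => eps A *: B)); last first.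
  split=> u c A B /=; first by rewrite linearP /= scalerDl scalerA.
  by rewrite scalerDr !scalerA mulrC.
move/eqP; rewrite -subr_eq0 -[X in _ - X](sum_splits_nil X (fun Y => W Y)) -sumrB.
have [r -> rP] := splits_full X; rewrite big_cons /= word_nil.
rewrite big_seq big1 => [|p pr]; last first.
  rewrite -scalerBl IH ?subrr ?scale0r //.
  exact: leq_trans (allP rP _ pr) leXn.
by rewrite addr0 -scalerBl scaler_eq0 oner_eq0 orbF subr_eq0 => /eqP.
Qed.

Lemma ext_word_cons x X a :
  ext (W (x :: X)) (letter a) =
  ext (letter x) (ext (W X) (letter a))
  - \sum_(Z <- acts (tri x) X) ext (W Z) (letter a).
Proof. by have [_ _ -> _ _] := hext; rewrite -(sum_set_nth _ 0). Qed.

(** The action preserves V. The induction is on length, since [acts] changes letters but not their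
    number. *)
Lemma ext_letter X a : exists v, ext (W X) (letter a) = letter v.
Proof.
have [e1 e2 _ _ _] := hext.
have [n] := ubnP (size X); elim: n X => // n IH [|x X] /ltnSE leXn.
  by exists a; rewrite word_nil e2.
have [u Eu] := IH X leXn.
have [v Ev] : exists v, \sum_(Z <- acts (tri x) X) ext (W Z) (letter a) = letter v.
  rewrite big_seq; elim/big_rec: _ => [|Z t ZX [v ->]].
    by exists 0; rewrite linear0.
  have [|w ->] := IH Z; last by exists (w + v); rewrite linearD.
  by rewrite (eqP (allP (all_size_acts _ _) _ ZX)).
by exists (tri x u - v); rewrite ext_word_cons Eu Ev e1 linearB.
Qed.

(** Coassociativity is built into the recursive [sw_iter], so one coproduct can be peeled off. *)
Lemma ext_cons A a Y :
  ext A (W (a :: Y)) =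
  \sum_(p <- sw_terms tens Delta A) ext p.1 (letter a) * ext p.2 (W Y).
Proof.
have [_ _ _ e4 e5] := hext.
rewrite e5; case: Y => [|b Y].
  (* For a single letter the second factor acts on 1 through [eps], and the counit identity restores
     A. *)
  rewrite /= big_seq1 /= big_seq1 /=.
  under eq_bigr => p _ do rewrite word_nil e4 -scalerAr mulr1 -linearZl_LR /=.
  by rewrite -linear_sumlz /= (heps A).2.
rewrite /= big_allpairs_dep; apply: eq_bigr => p _.
by rewrite e5 mulr_sumr; apply: eq_bigr => q _; rewrite /= big_cons.
Qed.

Lemma ext_word_word_cons X a Y :
  ext (W X) (W (a :: Y)) =
  \sum_(p <- splits X) ext (W p.1) (letter a) * ext (W p.2) (W Y).
Proof.
rewrite ext_cons (sw_wordT (f := fun A B => ext A (letter a) * ext B (W Y))) //.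
by split=> u c A B; rewrite linearPl ?mulrDl ?mulrDr -?scalerAl -?scalerAr.
Qed.

Lemma ext1 C : ext 1 C = C.
Proof.
have [_ e2 _ e4 _] := hext.
apply: (eq_on_words hT (f := ext 1) (g := idfun)) => [c A B|c A B|X] //.
  by rewrite linearP.
elim: X => [|a X IH] /=.
  by rewrite word_nil e4 -(word_nil letter) eps_word scale1r.
rewrite -(word_nil letter) ext_word_word_cons /= big_seq1 /= word_nil e2.
by rewrite IH word_cons.
Qed.

Lemma ext_eps X : ext (W X) 1 = (nilp X)%:R.
Proof. by have [_ _ _ -> _] := hext; rewrite eps_word scaler_nat. Qed.

(** A letter is primitive, hence acts as a derivation of the concatenation product. *)
Lemma ext_letter_word x Y : ext (letter x) (W Y) = \sum_(Z <- acts (tri x) Y) W Z.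
Proof.
have [e1 _ _ _ _] := hext.
elim: Y => [|y Y IH]; first by rewrite big_nil word_nil -word1 ext_eps.
rewrite -(word1 letter) ext_word_word_cons /= big_cons big_seq1 /=.
rewrite word1 word_nil !ext1 e1 IH big_cons big_map word_cons mulr_sumr.
by congr (_ + _); apply: eq_bigr => Z _; rewrite word_cons.
Qed.

Lemma ext_letter_letterM x a C :
  ext (letter x) (letter a * C) =
  letter (tri x a) * C + letter a * ext (letter x) C.
Proof.
move: C; apply: (eq_on_words hT) => [c A B|c A B|X].
- by rewrite mulrDr linearDr -!scalerAr linearZr_LR.
- by rewrite mulrDr linearPr mulrDr -!scalerAr scalerDr addrACA.
rewrite -word_cons !ext_letter_word big_cons big_map word_cons mulr_sumr.
by congr (_ + _); apply: eq_bigr => Z _; rewrite word_cons.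
Qed.

Lemma ext_letter_wordM x A C :
  ext (letter x) (W A * C) = ext (letter x) (W A) * C + W A * ext (letter x) C.
Proof.
elim: A => [|a A IH].
  by rewrite word_nil !mul1r -word1 ext_eps mul0r add0r.
rewrite word_cons -!mulrA !ext_letter_letterM IH.
by rewrite mulrDl mulrDr !addrA -!mulrA.
Qed.

(** The recursion defining the action on letters passes to all of T(V): x acts as a derivation, and
    replacing one letter of A is a coderivation ([splits_acts]). *)
Lemma ext_cons_word x A B :
  ext (W (x :: A)) B =
  ext (letter x) (ext (W A) B) - \sum_(Z <- acts (tri x) A) ext (W Z) B.
Proof.
move: B; apply: (eq_on_words hT) => [c B C|c B C|B].
- by rewrite linearP.
- rewrite !linearP scalerBr scaler_sumr addrACA -opprD -big_split.
  by congr (_ - _); apply: eq_bigr => Z _; rewrite linearP.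
elim: B A => [|b B IH] A.
  rewrite word_nil !ext_eps -(word1 letter) big_seq big1 => [|Z ZA]; last first.
    rewrite ext_eps; case: A ZA => // a A ZA.
    have /eqP := allP (all_size_acts _ _) _ ZA.
    by case: (Z).
  by rewrite subr0 linearMnr ext_eps mul0rn.
rewrite !ext_word_word_cons big_splits_cons linear_sum.
under [X in _ = _ - X]eq_bigr => Z _ do rewrite ext_word_word_cons.
rewrite (splits_acts (tri x) A
  (fun X Y => ext (W X) (letter b) * ext (W Y) (W B))) -sumrB.
(* The left factor sends b to a letter v, so the Leibniz rule for x applies to the product. *)
apply: eq_bigr => p _ /=; have [v Ev] := ext_letter p.1 b.
have [e1 _ _ _ _] := hext.
rewrite ext_word_cons IH Ev ext_letter_letterM e1 mulrBl mulrBr.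
by rewrite mulr_suml mulr_sumr opprD addrACA.
Qed.

(** * The product [circ] and its action on letters *)

Lemma circ_linearl B : linear (circ^~ B).
Proof.
apply: (sw_linear hT hTT hDelta (f := fun A C => A * ext C B)).
split=> u c A C /=; first by rewrite mulrDl scalerAl.
by rewrite linearPl mulrDr scalerAr.
Qed.

Lemma circ_word A B :
  circ (W A) B = \sum_(p <- splits A) W p.1 * ext (W p.2) B.
Proof.
apply: (sw_wordT (f := fun A C => A * ext C B)).
split=> u c X C /=; first by rewrite mulrDl scalerAl.
by rewrite linearPl mulrDr scalerAr.
Qed.

(** The first two terms together are x o (A o B), because x is primitive. *)
Lemma circ_word_cons x A B :
  circ (W (x :: A)) B =
  letter x * circ (W A) B + ext (letter x) (circ (W A) B)
  - \sum_(Z <- acts (tri x) A) circ (W Z) B.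
Proof.
rewrite !circ_word big_splits_cons.
under [X in _ = _ - X]eq_bigr => Z _ do rewrite circ_word.
rewrite (splits_acts (tri x) A (fun X Y => W X * ext (W Y) B)).
rewrite linear_sum mulr_sumr -big_split -sumrB; apply: eq_bigr => p _ /=.
rewrite ext_cons_word ext_letter_wordM ext_letter_word word_cons mulrA.
rewrite mulrBr mulr_suml mulr_sumr -!addrA; congr (_ + _).
by rewrite opprD addrCA !addrA addrK.
Qed.

Lemma ext_letter_circ x C a :
  ext (letter x * C + ext (letter x) C) (letter a) =
  ext (letter x) (ext C (letter a)).
Proof.
move: C; apply: (eq_on_words hT) => [c A B|c A B|X].
- by rewrite linearP /= mulrDr -scalerAr addrACA -scalerDr linearPl.
- by rewrite linearPl linearP.
by rewrite linearDl ext_letter_word linear_sumlz -word_cons ext_word_cons subrK.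
Qed.

(** Both sides obey the same recursion in the first letter of A, by [circ_word_cons] and
    [ext_cons_word]. *)
Lemma ext_circ A B a : ext (circ A B) (letter a) = ext A (ext B (letter a)).
Proof.
move: A; apply: (eq_on_words hT) => [c X Y|c X Y|A].
- by rewrite circ_linearl linearPl.
- by rewrite linearPl.
have [n] := ubnP (size A); elim: n A => // n IH [|x A] /ltnSE leAn.
  by rewrite circ_word /= big_seq1 /= word_nil mul1r !ext1.
rewrite circ_word_cons linearBl ext_letter_circ IH // ext_cons_word.
rewrite linear_sumlz; congr (_ - _); rewrite big_seq [RHS]big_seq.
apply: eq_bigr => Z ZA; apply: IH.
by rewrite (eqP (allP (all_size_acts _ _) _ ZA)).
Qed.

(** * The antipode acting on letters *)

Variable S : {linear T -> T}.
Hypothesis hS : is_antipode tens Delta eps ext S.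

Lemma antipode_word X a :
  \sum_(p <- splits X) ext (S (W p.1)) (ext (W p.2) (letter a))
  = (nilp X)%:R *: letter a.
Proof.
have := (hS (W X)).1; rewrite (sw_wordT (f := fun A B => circ (S A) B)).
  move=> /(congr1 (ext^~ (letter a))); rewrite linearZl_LR /= ext1 eps_word => <-.
  by rewrite linear_sumlz; apply: eq_bigr => p _; rewrite ext_circ.
split=> u c A B; first by rewrite linearP circ_linearl.
rewrite /= /Defs.circ scaler_sumr -big_split; apply: eq_bigr => p _.
by rewrite linearP mulrDr scalerAr.
Qed.

(* X |-> (S X |> _) is the left convolution inverse of X |-> (X |> _), and the
   latter satisfies (x X |> _) = x |> (X |> _) - sum of (Z |> _) over acts. *)
Lemma antipode_cons x X a :
  ext (S (W (x :: X))) (letter a) =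
  - (ext (S (W X)) (letter (tri x a))
     + \sum_(Z <- acts (tri x) X) ext (S (W Z)) (letter a)).
Proof.
have [e1 _ _ _ _] := hext.
have [n] := ubnP (size X); elim: n X a => // n IH X a /ltnSE leXn.
pose s Y b := ext (S (W Y)) b.
(* [Q p] is the defect of the claim for the word [p.1] and the letter [p.2] |> a. The defects sum to
   0 over all splits and vanish by induction for shorter [p.1], so the defect of the full split
   vanishes too. *)
pose Q (p : seq V * seq V) := s (x :: p.1) (ext (W p.2) (letter a))
  + s p.1 (ext (letter x) (ext (W p.2) (letter a)))
  + \sum_(Z <- acts (tri x) p.1) s Z (ext (W p.2) (letter a)).
have Q0 : \sum_(p <- splits X) Q p = 0.
  have := antipode_word (x :: X) a; rewrite big_splits_cons /= scale0r => A0.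
  (* Each Z is as long as X, hence nonempty, and the counit kills it. *)
  have C0 : \sum_(Z <- acts (tri x) X) \sum_(p <- splits Z)
      s p.1 (ext (W p.2) (letter a)) = 0.
    rewrite big_seq big1 // => Z ZX; rewrite antipode_word.
    case: X ZX {leXn Q A0} => // y X ZX.
    have /eqP := allP (all_size_acts _ _) _ ZX.
    by case: (Z) => // *; rewrite scale0r.
  have := congr2 +%R A0 C0; rewrite addr0; apply: etrans.
  rewrite (splits_acts (tri x) X (fun Y Z => s Y (ext (W Z) (letter a)))).
  rewrite -big_split; apply: eq_bigr => p _ /=; rewrite /Q /s ext_word_cons.
  rewrite linearBr linear_sumr -!addrA; congr (_ + (_ + _)).
  by rewrite addrCA addNr addr0.
have [r Er rP] := splits_full X; move: Q0; rewrite Er big_cons big_seq big1.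
  by rewrite addr0 /Q /= word_nil ext1 e1 -addrA => /eqP; rewrite addr_eq0 => /eqP.
move=> p pr; have [v Ev] := ext_letter p.2 a.
rewrite /Q /s Ev IH; last exact: leq_trans (allP rP _ pr) leXn.
by rewrite e1 -addrA addNr.
Qed.

(** * The product [black] on letters *)

Variable black : {bilinear T -> T -> T}.
Hypothesis hblack : is_black letter ext S black.

Lemma black_nil a : black 1 (letter a) = letter a.
Proof.
rewrite -(word_nil letter) -(word1 letter) hblack scale1r word1.
have := antipode_word [::] a.
by rewrite /= big_seq1 /= word_nil ext1 scale1r.
Qed.

(** The sign in the definition of [black] absorbs the minus sign of [antipode_cons], leaving a
    recursion with positive terms. *)
Lemma black_cons x X a :
  black (W (x :: X)) (letter a) =
  black (W X) (letter (tri x a))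
  + \sum_(Z <- acts (tri x) X) black (W Z) (letter a).
Proof.
have bE Y b : black (W Y) (letter b) = (-1) ^+ size Y *: ext (S (W Y)) (letter b).
  by rewrite -(word1 letter) hblack.
rewrite !bE antipode_cons exprS mulN1r scaleNr scalerN opprK scalerDr.
congr (_ + _); rewrite scaler_sumr big_seq [RHS]big_seq.
apply: eq_bigr => Z ZX; rewrite bE.
by rewrite (eqP (allP (all_size_acts _ _) _ ZX)).
Qed.

Lemma black_letter X a : exists v, black (W X) (letter a) = letter v.
Proof.
have [n] := ubnP (size X); elim: n X a => // n IH [|x X] a /ltnSE leXn.
  by exists a; rewrite word_nil black_nil.
have [u Eu] := IH X (tri x a) leXn; rewrite black_cons Eu.
rewrite big_seq; elim/big_rec: _ => [|Z t ZX [v Ev]].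
  by exists u; rewrite addr0.
have [|w ->] := IH Z a; last by exists (w + v); rewrite addrCA Ev linearD.
by rewrite (eqP (allP (all_size_acts _ _) _ ZX)).
Qed.

End PostHopf.

(** * Brackets *)

Section Permutations.
Variable M : zmodType.

(** One-line notation is injective and both sides range over n! lists. *)
Lemma sum_perm n (F : seq nat -> M) :
  \sum_(w : 'S_n) F [seq val (w j) | j <- enum 'I_n]
  = \sum_(l <- permutations (iota 0 n)) F l.
Proof.
pose g (w : 'S_n) := [seq val (w j) | j <- enum 'I_n].
transitivity (\sum_(l <- [seq g w | w <- enum {: 'S_n}]) F l).
  by rewrite big_map big_enum.
apply: perm_big.
have g_inj : injective g.
  move=> v w /eq_in_map vw; apply/permP => j.
  by apply: val_inj; apply: vw; rewrite mem_enum.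
have g_uniq : uniq [seq g w | w <- enum {: 'S_n}] by rewrite map_inj_uniq ?enum_uniq.
apply: uniq_perm => //; first exact: permutations_uniq.
apply: (uniq_min_size g_uniq _ _).2 => [l /mapP[w _ ->]|].
  rewrite mem_permutations -val_enum_ord /g map_comp perm_map //.
  apply: uniq_perm; rewrite ?(map_inj_uniq perm_inj) ?enum_uniq //.
  move=> j; rewrite mem_enum; apply/mapP; exists (w^-1%g j); rewrite ?mem_enum //.
  by rewrite permKV.
by rewrite size_permutations ?iota_uniq // size_iota size_map -cardE card_Sn.
Qed.

Definition insert0 i (l : seq nat) := take i l ++ 0%N :: drop i l.

Lemma perm_insert0 i l : perm_eq (insert0 i l) (0%N :: l).
Proof. by rewrite /insert0 -cat1s perm_catCA cat_take_drop. Qed.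

(** Inserting 0 into a shifted permutation is injective, and (n+1) n! = (n+1)! shows that every
    permutation arises. *)
Lemma sum_permutations n (F : seq nat -> M) :
  \sum_(l <- permutations (iota 0 n.+1)) F l =
  \sum_(l <- permutations (iota 0 n)) \sum_(i < n.+1)
    F (insert0 i [seq j.+1 | j <- l]).
Proof.
transitivity (\sum_(r <- [seq insert0 i [seq j.+1 | j <- l]
    | l <- permutations (iota 0 n), i <- iota 0 n.+1]) F r); last first.
  rewrite big_allpairs_dep; apply: eq_bigr => l _.
  rewrite -(big_mkord xpredT (fun i => F (insert0 i [seq j.+1 | j <- l]))).
  by rewrite /index_iota subn0.
apply: perm_big; rewrite perm_sym.
set s := [seq _ | l <- _, i <- _].
have s_uniq : uniq s.
  apply: allpairs_uniq; rewrite ?iota_uniq ?permutations_uniq //.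
  move=> u v /allpairsP[[l' i'] [l'P i'P ->]] /allpairsP[[m' j'] [m'P j'P ->]].
  move: l'P i'P m'P j'P => /= l'P i'P m'P j'P E.
  have n0 r : 0%N \notin [seq j.+1 | j <- r] by apply/mapP => -[].
  (* The position of 0 recovers the place of insertion, and deleting 0 recovers the shifted
     permutation. *)
  have ind r t : r \in permutations (iota 0 n) -> t \in iota 0 n.+1 ->
      index 0%N (insert0 t [seq j.+1 | j <- r]) = t.
    rewrite mem_permutations => /perm_size; rewrite size_iota => sr.
    rewrite mem_iota /= add0n ltnS => tn.
    rewrite /insert0 index_cat ifN; last by apply: contra (n0 r); apply: mem_take.
    by rewrite /= addn0 size_takel // size_map sr.
  have rmv r t : rem 0%N (insert0 t [seq j.+1 | j <- r]) = [seq j.+1 | j <- r].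
    have := n0 r; rewrite -{1}(cat_take_drop t [seq j.+1 | j <- r]) mem_cat.
    rewrite /insert0; case/norP => n1 _.
    rewrite remE index_cat (negPf n1) /= addn0 take_cat ltnn subnn take0 cats0.
    by rewrite drop_cat ltnNge leqnSn /= subSnn /= drop0 cat_take_drop.
  congr (_, _); first by apply: (inj_map succn_inj); rewrite -(rmv l' i') E rmv.
  by rewrite -(ind l' i') // E ind.
apply: uniq_perm => //; first exact: permutations_uniq.
apply: (uniq_min_size s_uniq _ _).2 => [r /allpairsP[[l i] /= [lP iP ->]]|].
  rewrite mem_permutations (permPl (perm_insert0 _ _)) /= perm_cons.
  by rewrite (iotaDl 1 0) perm_map // -mem_permutations.
rewrite size_allpairs !size_permutations ?iota_uniq // !size_iota.
by rewrite factS mulnC.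
Qed.
End Permutations.

(** * The recursion for the sum of brackets *)

Section Brackets.
Variables (E : Type) (op : E -> E -> E).

Implicit Types (s : seq (seq nat * E)) (A C : seq nat * E).

(* Matches the states of the bracketing of x X, once the symbol 0 of x is merged,
   with those of the bracketing of a word as long as X. *)
Definition unlabel0 A := ([seq j.-1 | j <- A.1 & j != 0%N], A.2).

Lemma mem_unlabel0 j A : (j \in (unlabel0 A).1) = (j.+1 \in A.1).
Proof.
apply/mapP/idP => [[i]|jA].
  by rewrite mem_filter; case: i => // i /= iA ->.
by exists j.+1; rewrite // mem_filter.
Qed.

Lemma merge_at_unlabel0 j s :
  merge_at op j [seq unlabel0 A | A <- s] =
  [seq unlabel0 A | A <- merge_at op j.+1 s].
Proof.
elim: s => [|A [|C s] IH] //=; rewrite -/(unlabel0 A) (mem_unlabel0 j A).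
case: ifP => _ /=; first by rewrite /unlabel0 filter_cat map_cat.
by congr (_ :: _).
Qed.

Lemma foldl_merge_unlabel0 i n s :
  foldl (fun t j => merge_at op j t) [seq unlabel0 A | A <- s] (iota i n) =
  [seq unlabel0 A | A <-
    foldl (fun t j => merge_at op j t) s (iota i.+1 n)].
Proof. by elim: n i s => //= n IH i s; rewrite merge_at_unlabel0 IH. Qed.

Lemma merge_at_cat j s A C t :
  all (fun B => j \notin B.1) s -> j \in A.1 ->
  merge_at op j (s ++ A :: C :: t) = s ++ (A.1 ++ C.1, op A.2 C.2) :: t.
Proof.
move=> + jA; elim: s => [_|B s IH /= /andP[/negPf jB js]] /=; first by rewrite jA.
by rewrite IH //; case: s {IH js} => [|B' s] /=; rewrite jB.
Qed.

Lemma nilp_foldl_merge s r :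
  nilp (foldl (fun t j => merge_at op j t) s r) = nilp s.
Proof.
elim: r s => //= j r IH s; rewrite IH.
by case: s => [|A [|C s]] //=; case: ifP.
Qed.

(** Step 0 merges x with its right neighbour: Y if x stands last among the symbols, else the letter
    numbered by entry i of l. The remaining steps bracket a word as long as X, with labels shifted
    by one. *)
Lemma bracket_from_insert0 x X Y l i :
  perm_eq l (iota 0 (size X)) -> (i <= size X)%N ->
  bracket_from op (x :: X) Y (insert0 i [seq j.+1 | j <- l]) =
  if i == size X then bracket_from op X (op x Y) l
  else let j := nth 0%N l i in
       bracket_from op (set_nth Y X j (op x (nth Y X j))) Y l.
Proof.
move=> lP leiX; have sl : size l = size X by rewrite (perm_size lP) size_iota.
have l_uniq : uniq l by rewrite (perm_uniq lP) iota_uniq.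
have lX j : j \in l -> (j < size X)%N by rewrite (perm_mem lP) mem_iota.
rewrite /bracket_from /= /insert0 -map_take -map_drop.
rewrite map_cat rcons_cat /= -!map_comp.
set u := map _ (take i l).
have u0 : all (fun B => 0%N \notin B.1) u by rewrite all_map; apply/allP.
(* A state never becomes empty, so the two differing defaults of [head] do not matter. *)
have hd n d d' s t : ~~ nilp s -> [seq unlabel0 A | A <- s] = t ->
    (head d (foldl (fun t j => merge_at op j t) s (iota 1 n))).2 =
    (head d' (foldl (fun t j => merge_at op j t) t (iota 0 n))).2.
  rewrite -(nilp_foldl_merge s (iota 1 n)) => nz <-.
  by rewrite foldl_merge_unlabel0; case: foldl nz.
have nn (s t : seq (seq nat * E)) A : ~~ nilp (s ++ A :: t) by case: s.
case: eqP => [iX|/eqP neiX].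
  rewrite drop_oversize ?sl ?iX //= merge_at_cat //.
  apply: hd; rewrite ?nn // map_cat -cats1 -map_comp take_oversize ?sl ?iX //.
  congr (_ ++ _); apply/eq_in_map => j /lX jX.
  by rewrite /unlabel0 /=; congr (_, _); apply: set_nth_default.
have {leiX neiX} ltil : (i < size l)%N by rewrite sl ltn_neqAle neiX.
set j := nth 0%N l i; cbv zeta.
have jX : (j < size X)%N by apply/lX/mem_nth.
rewrite (drop_nth 0%N ltil) /= merge_at_cat // size_set_nth (maxn_idPr jX).
have El : l = take i l ++ j :: drop i.+1 l by rewrite -drop_nth ?cat_take_drop.
apply: hd; rewrite ?nn // [in RHS]El.
rewrite !map_cat rcons_cat /= map_rcons -!map_comp.
have := l_uniq; rewrite [in uniq _]El.
rewrite cat_uniq /= negb_or -!andbA => /and5P[_ jt _ jd _].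
have nj (a : nat) (r : seq nat) : a \in r -> j \notin r ->
    unlabel0 ([:: a.+1], nth Y X a) =
    ([:: a], nth Y (set_nth Y X j (op x (nth Y X j))) a).
  move=> aS jS; rewrite /unlabel0 /= nth_set_nth /=; case: eqP => // aj.
  by rewrite aj (negPf jS) in aS.
congr (_ ++ _ :: rcons _ _).
- by apply/eq_in_map => a at_; apply: nj jt.
- by rewrite nth_set_nth /= eqxx.
- by apply/eq_in_map => a ad; apply: nj jd.
Qed.

End Brackets.

Section BracketSum.
Variables (E : zmodType) (op : E -> E -> E).

Definition bracket_sum X Y : E :=
  \sum_(w : 'S_(size X)) bracket op Y w.

Lemma bracket_sum_nil Y : bracket_sum [::] Y = Y.
Proof.
rewrite /bracket_sum (eq_bigr (fun=> Y)) => [|w _].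
  by rewrite sumr_const card_Sn.
by rewrite /bracket (size0nil (size_enum_ord 0)).
Qed.

Lemma bracket_sum_cons x X Y :
  bracket_sum (x :: X) Y =
  bracket_sum X (op x Y) + \sum_(Z <- acts (op x) X) bracket_sum Z Y.
Proof.
have bsE X' Y' : bracket_sum X' Y' =
    \sum_(l <- permutations (iota 0 (size X'))) bracket_from op X' Y' l.
  by rewrite -sum_perm.
rewrite !bsE sum_permutations.
rewrite -(sum_set_nth (op x) Y X (fun Z => bracket_sum Z Y)).
transitivity (\sum_(l <- permutations (iota 0 (size X)))
  (bracket_from op X (op x Y) l + \sum_(j < size X)
     bracket_from op (set_nth Y X j (op x (nth Y X j))) Y l)); last first.
  rewrite big_split exchange_big; congr (_ + _); apply: eq_bigr => j _.
  by rewrite bsE size_set_nth (maxn_idPr (ltn_ord j)).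
apply: eq_big_seq => l; rewrite mem_permutations => lP.
rewrite big_ord_recr addrC /= bracket_from_insert0 // eqxx; congr (_ + _).
(* As l permutes the positions of X, the right neighbour of x runs over each letter of X exactly
   once. *)
pose G j := bracket_from op (set_nth Y X j (op x (nth Y X j))) Y l.
rewrite -(big_mkord xpredT G) /index_iota subn0 -(perm_big _ lP) (big_nth 0%N).
rewrite (perm_size lP) size_iota big_mkord; apply: eq_bigr => i _.
by rewrite bracket_from_insert0 ?ltn_eqF // ltnW.
Qed.
End BracketSum.

(** * Set partitions of words *)

Section Parts.
Variable A : Type.

(* The set partitions of the positions of X, blocks listed by increasing last
   position; x comes first, so adding it to a block does not change the order. *)
Fixpoint parts (X : seq A) : seq (seq (seq A)) :=
  if X is x :: X' then
    flatten [seq ([:: x] :: P) :: acts (cons x) P | P <- parts X']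
  else [:: [::]].

Lemma big_parts_cons (M : zmodType) x X (G : seq (seq A) -> M) :
  \sum_(P <- parts (x :: X)) G P =
  \sum_(P <- parts X) (G ([:: x] :: P) + \sum_(Q <- acts (cons x) P) G Q).
Proof.
by rewrite /= big_flatten big_map; apply: eq_bigr => P _; rewrite big_cons.
Qed.

Lemma acts_map (B : Type) (h : A -> B) f g X :
  (forall a, h (f a) = g (h a)) ->
  acts g [seq h a | a <- X] = [seq [seq h a | a <- Z] | Z <- acts f X].
Proof.
move=> hf; elim: X => //= y X ->; rewrite hf -!map_comp.
by congr (_ :: _); apply: eq_map.
Qed.


Fixpoint deep_acts (f : A -> A) (P : seq (seq A)) : seq (seq (seq A)) :=
  if P is B :: P' then
    [seq C :: P' | C <- acts f B] ++ [seq B :: Q | Q <- deep_acts f P']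
  else [::].

Section Sums.
Variables (M : zmodType) (f : A -> A).

Lemma big_deep_acts_cons B P (G : seq (seq A) -> M) :
  \sum_(Q <- deep_acts f (B :: P)) G Q =
  \sum_(C <- acts f B) G (C :: P) + \sum_(Q <- deep_acts f P) G (B :: Q).
Proof. by rewrite big_cat !big_map. Qed.

(** After y has joined a block, the changed letter is either y itself or a letter already in P. *)
Lemma deep_acts_insert y P (G : seq (seq A) -> M) :
  \sum_(Q <- acts (cons y) P) \sum_(R <- deep_acts f Q) G R =
  \sum_(Q <- acts (cons (f y)) P) G Q
  + \sum_(Q <- deep_acts f P) \sum_(R <- acts (cons y) Q) G R.
Proof.
elim: P G => [|B P IH] G; first by rewrite !big_nil addr0.
rewrite !big_acts_cons !big_deep_acts_cons big_acts_cons.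
under [X in _ + X = _]eq_bigr => Q _ do rewrite big_deep_acts_cons.
under [X in _ = _ + (X + _)]eq_bigr => Q _ do rewrite big_acts_cons.
under [X in _ = _ + (_ + X)]eq_bigr => Q _ do rewrite big_acts_cons.
rewrite !big_split /= (IH (fun Q => G (B :: Q))) exchange_big /=.
by rewrite (AC (3*(1*2)) ((1*5)*((2*4)*(3*6)))).
Qed.

(** Changing a letter before partitioning amounts to changing it inside its block afterwards. *)
Lemma acts_parts X (G : seq (seq A) -> M) :
  \sum_(Z <- acts f X) \sum_(P <- parts Z) G P =
  \sum_(P <- parts X) \sum_(Q <- deep_acts f P) G Q.
Proof.
elim: X G => [|y X IH] G; first by rewrite /= big_seq1 !big_nil.
rewrite big_acts_cons !big_parts_cons.
under [X in _ + X = _]eq_bigr => Z _ do rewrite big_parts_cons.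
rewrite (IH (fun P => G ([:: y] :: P) + \sum_(Q <- acts (cons y) P) G Q)).
rewrite -big_split; apply: eq_bigr => P _ /=.
rewrite deep_acts_insert big_cons big_map big_split /=.
by rewrite (AC (2*2) ((1*3)*(2*4))).
Qed.
End Sums.

Lemma big_acts_rcons (M : zmodType) f X a (G : seq A -> M) :
  \sum_(Z <- acts f (rcons X a)) G Z =
  \sum_(Z <- acts f X) G (rcons Z a) + G (rcons X (f a)).
Proof.
elim: X G => [|y X IH] G; first by rewrite /= big_seq1 big_nil add0r.
by rewrite rcons_cons !big_acts_cons (IH (fun Z => G (y :: Z))) addrA.
Qed.

End Parts.

(** Partitions of a word are thereby read off from those of its positions, which are distinct even
    if letters repeat. *)
Lemma parts_map (A B : Type) (h : A -> B) X :
  parts [seq h a | a <- X] = [seq [seq [seq h a | a <- C] | C <- P] | P <- parts X].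
Proof.
elim: X => //= x X ->; rewrite map_flatten -!map_comp; congr flatten.
by apply: eq_map => P /=; rewrite (acts_map (f := cons x)).
Qed.

(** * Characterization of [parts] on increasing lists *)

Lemma mem_actsP (A : eqType) (f : A -> A) X Z :
  reflect (exists X1 a X2, X = X1 ++ a :: X2 /\ Z = X1 ++ f a :: X2)
          (Z \in acts f X).
Proof.
elim: X Z => [|y X IH] Z.
  by apply: ReflectF => -[[|? ?] [? [? []]]].
rewrite /= inE; apply: (iffP orP) => [[/eqP->|/mapP[Z' ZP ->]]|].
- by exists [::], y, X.
- case/IH: ZP => X1 [a [X2 [-> ->]]]; by exists (y :: X1), a, X2.
case=> -[|z X1] [a [X2 [/= [-> EX] ->]]]; first by left; rewrite EX.
by right; apply: (map_f (cons z)); apply/IH; exists X1, a, X2.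
Qed.

(** The map [u] recovers the index a from any member of [g a], which makes these lists pairwise
    disjoint. *)
Lemma uniq_flatten_map (A B : eqType) (g : A -> seq B) (u : B -> A) (s : seq A) :
  uniq s -> {in s, forall a, uniq (g a)} ->
  {in s, forall a, {in g a, forall b, u b = a}} ->
  uniq (flatten [seq g a | a <- s]).
Proof.
elim: s => //= a s IH /andP[nas us] ug gu.
rewrite cat_uniq ug ?mem_head // IH //; last 2 first.
- by move=> b bs; apply: ug; rewrite inE bs orbT.
- by move=> b bs; apply: gu; rewrite inE bs orbT.
rewrite andbT; apply/hasPn => b /flattenP[_ /mapP[c cs ->] bc].
apply: contra nas => /= ba.
by rewrite -(gu a _ b ba) ?mem_head // (gu c _ b bc) // inE cs orbT.
Qed.

Lemma flatten_uniq_inj (A : eqType) (Q : seq (seq A)) B C a :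
  uniq (flatten Q) -> B \in Q -> C \in Q -> a \in B -> a \in C -> B = C.
Proof.
elim: Q => //= D Q IH; rewrite cat_uniq => /and3P[_ /hasPn DQ uQ].
rewrite !inE => /orP[/eqP->|BQ] /orP[/eqP->|CQ] // aB aC; last exact: IH.
- by have /DQ/negP[] : a \in flatten Q by apply/flattenP; exists C.
- by have /DQ/negP[] : a \in flatten Q by apply/flattenP; exists B.
Qed.

Definition ordered_partition (s : seq nat) (Q : seq (seq nat)) : bool :=
  [&& perm_eq (flatten Q) s,
      all (fun B => ~~ nilp B && sorted ltn B) Q &
      sorted ltn [seq last 0%N B | B <- Q]].

Lemma last_mem_ne (B : seq nat) : ~~ nilp B -> last 0%N B \in B.
Proof. by case: B => //= b B _; rewrite mem_last. Qed.

(** The least element x heads its block. Removing it deletes a singleton, necessarily the first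
    block, or shortens a larger block without changing its last element. *)
Lemma parts_ordered_partition s Q :
  sorted ltn s -> (Q \in parts s) = ordered_partition s Q.
Proof.
elim: s Q => [|x s IH] Q.
  move=> _; rewrite /= inE /ordered_partition.
  apply/eqP/and3P => [->//|[/perm_nilP + Qne _]].
  by case: Q Qne => //= -[|b B] Q.
rewrite /= (path_sortedE ltn_trans) => /andP[xs ss].
apply/idP/idP.
  case/flattenP=> _ /mapP[P + ->]; rewrite IH // inE => /and3P[Ps Pne Plt].
  have xP B : B \in P -> all (ltn x) B.
    move=> BP; apply/allP => b bB; apply: (allP xs).
    by rewrite -(perm_mem Ps); apply/flattenP; exists B.
  case/orP=> [/eqP->|/mem_actsP[P1 [B [P2 [EP ->]]]]].
    rewrite /ordered_partition /= perm_cons Ps Pne /=.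
    rewrite (path_sortedE ltn_trans) Plt andbT all_map; apply/allP => B BP /=.
    by apply/(allP (xP B BP))/last_mem_ne; have /andP[] := allP Pne B BP.
  have BP : B \in P by rewrite EP mem_cat mem_head orbT.
  have xB := xP B BP; move: Ps Pne Plt xB; rewrite EP {EP xP BP}.
  rewrite /ordered_partition !flatten_cat /= !all_cat /= !map_cat /=.
  move=> Ps /and3P[-> /andP[Bne Bs] ->] Plt xB.
  rewrite -[x :: B ++ _]cat1s perm_catCA /= perm_cons Ps /=.
  rewrite (path_sortedE ltn_trans) xB Bs /=.
  (* As B is nonempty, prepending x keeps its last element. *)
  by move: Plt; case: (B) Bne.
case/and3P=> Qs Qne Qlt.
have /flattenP[B BQ xB] : x \in flatten Q by rewrite (perm_mem Qs) mem_head.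
have Qx C c : C \in Q -> c \in C -> (x <= c)%N.
  move=> CQ cC; have : c \in x :: s.
    by rewrite -(perm_mem Qs); apply/flattenP; exists C.
  by rewrite inE => /orP[/eqP->//|/(allP xs)/ltnW].
have [Bne Bs] := andP (allP Qne B BQ).
have {Bne xB} [B' EB] : exists B', B = x :: B'.
  case: B BQ xB Bne Bs => // y B BQ.
  rewrite inE => /orP[/eqP->|xB] _; first by exists B.
  rewrite /= (path_sortedE ltn_trans) => /andP[/allP/(_ x xB) /= + _].
  by rewrite ltnNge (Qx (y :: B)) ?mem_head.
subst B; case/splitPr: BQ Qs Qne Qlt Qx => P1 P2.
rewrite flatten_cat all_cat map_cat /= => Qs /and3P[P1ne xB' P2ne] Qlt Qx.
move: Qs; rewrite -[x :: B' ++ _]cat1s perm_catCA /= perm_cons => Qs.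
apply/flattenP.
case: B' => [|b B'] in Bs Qs Qlt xB' Qx *.
  (* A block before [[:: x]] would have its last element below the minimum x. *)
  have EP1 : P1 = [::].
    case: P1 P1ne Qlt Qx {Qs} => //= C P1 /andP[/andP[Cne _] _] + Qx.
    rewrite (path_sortedE ltn_trans) all_cat /= => /andP[/and3P[_ + _] _].
    by rewrite ltnNge (Qx C) ?mem_head ?last_mem_ne.
  exists (([:: x] :: P2) :: acts (cons x) P2); last by rewrite EP1 mem_head.
  apply: map_f; rewrite IH // /ordered_partition P2ne.
  move: Qs Qlt; rewrite EP1 /= => -> /=.
  by rewrite (path_sortedE ltn_trans) => /andP[].
pose P := P1 ++ (b :: B') :: P2.
exists (([:: x] :: P) :: acts (cons x) P).
  apply: map_f; rewrite IH // /ordered_partition flatten_cat all_cat map_cat /=.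
  by rewrite Qs P1ne P2ne Qlt; move: xB'; rewrite /= => /andP[_ ->].
by rewrite inE; apply/orP; right; apply/mem_actsP; exists P1, (b :: B'), P2.
Qed.

Lemma parts_uniq s : sorted ltn s -> uniq (parts s).
Proof.
elim: s => // x s IH; rewrite /= (path_sortedE ltn_trans) => /andP[xs ss].
(* Deleting x, and the block it leaves empty, recovers the partition of s from which Q was built. *)
pose u (Q : seq (seq nat)) := 
  [seq B <- [seq [seq b <- B | b != x] | B <- Q] | ~~ nilp B].
have uE P : P \in parts s -> u P = P.
  rewrite parts_ordered_partition // => /and3P[Ps Pne _].
  rewrite /u; transitivity [seq B <- P | ~~ nilp B].
    congr filter; rewrite -[RHS]map_id; apply/eq_in_map => B BP.
    apply/all_filterP/allP => b bB; rewrite neq_ltn [(x < b)%N](allP xs) ?orbT //.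
    by rewrite -(perm_mem Ps); apply/flattenP; exists B.
  by apply/all_filterP/allP => B /(allP Pne)/andP[].
apply: (uniq_flatten_map (u := u)) => [|P Ps|P Ps Q]; first exact: IH.
  rewrite cons_uniq; apply/andP; split.
    apply/negP => /mem_actsP[P1 [B [P2 [E1 E2]]]].
    have : size P = size (P1 ++ (x :: B) :: P2) by rewrite E1 !size_cat.
    by rewrite -E2 => /n_Sn.
  elim: P {Ps} => //= B P IHP; rewrite map_inj_uniq ?IHP ?andbT => [|? ? []//].
  apply/mapP => -[Q _ [/(congr1 size) /= /eqP]].
  by rewrite eqn_leq ltnn.
rewrite inE => QP; rewrite -[RHS](uE P Ps).
case/orP: QP => [/eqP->|/mem_actsP[P1 [B [P2 [-> ->]]]]].
  by rewrite /u /= eqxx.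
by rewrite /u !map_cat /= eqxx.
Qed.

(** * Comparison with set partitions of the ordinals below n *)

Section SortedBlocks.
Variable n : nat.
Implicit Types (P : {set {set 'I_n}}) (B C : {set 'I_n}).

Definition positions B : seq nat := [seq val i | i <- enum B].

Lemma positions_sorted B : sorted ltn (positions B).
Proof.
rewrite /positions sorted_map {1}/enum_mem sorted_filter //.
  by move=> i j l; apply: ltn_trans.
by rewrite -sorted_map -enumT val_enum_ord iota_ltn_sorted.
Qed.

Lemma mem_positions (i : 'I_n) B : (val i \in positions B) = (i \in B).
Proof. by rewrite mem_map ?mem_enum //; apply: val_inj. Qed.

Lemma positions_inj : injective positions.
Proof. by move=> B C E; apply/setP => i; rewrite -!mem_positions E. Qed.

Lemma nilp_positions B : nilp (positions B) = (B == set0).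
Proof. by rewrite /nilp size_map -cardE cards_eq0. Qed.

Lemma last_positions B :
  B != set0 -> last 0%N (positions B) = (\max_(i in B) val i)%N.
Proof.
rewrite -nilp_positions => Bne; apply/eqP; rewrite eqn_leq; apply/andP; split.
  by have /mapP[i + ->] := last_mem_ne Bne; rewrite mem_enum; apply: leq_bigmax_cond.
apply/bigmax_leqP => i; rewrite -mem_positions => iB.
have := positions_sorted B; case/splitPr: iB => s1 s2.
rewrite last_cat /= sorted_cat_cons => /andP[_ /(order_path_min ltn_trans)/allP s2i].
by have := mem_last (val i) s2; rewrite inE => /orP[/eqP->|/s2i/ltnW].
Qed.

Definition blocks P : seq (seq nat) := [seq positions B | B <- sorted_blocks P].

Lemma mem_sorted_blocks P B : (B \in sorted_blocks P) = (B \in P).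
Proof. by rewrite mem_sort mem_enum. Qed.

Lemma blocks_inj : injective blocks.
Proof.
move=> P Q /(inj_map positions_inj) E.
by apply/setP => B; rewrite -!mem_sorted_blocks E.
Qed.

Lemma blocks_ordered_partition P :
  partition P [set: 'I_n] -> ordered_partition (iota 0 n) (blocks P).
Proof.
move=> /and3P[/eqP covP trP P0].
have ne B : B \in P -> B != set0 by apply: contraTneq => ->.
apply/and3P; split.
- rewrite /blocks -val_enum_ord.
  have -> : flatten [seq positions B | B <- sorted_blocks P] =
      [seq val i | i <- flatten [seq enum B | B <- sorted_blocks P]].
    by rewrite map_flatten -map_comp.
  apply/perm_map/uniq_perm => [||i]; last first; [|exact: enum_uniq|].
  + rewrite mem_enum inE; apply/flattenP.
    have : i \in cover P by rewrite covP inE.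
    case/bigcupP=> B BP iB; exists (enum B); rewrite ?mem_enum //.
    by apply: map_f; rewrite mem_sorted_blocks.
  + apply: (uniq_flatten_map (u := pblock P)) => [|B _|B + i].
    * by rewrite sort_uniq enum_uniq.
    * exact: enum_uniq.
    * by rewrite mem_sorted_blocks mem_enum; apply: def_pblock.
- apply/allP => _ /mapP[B + ->]; rewrite mem_sorted_blocks nilp_positions => BP.
  by rewrite positions_sorted ne.
- rewrite -map_comp (_ : map _ _ =
    [seq (\max_(i in B) val i)%N | B <- sorted_blocks P]); last first.
    by apply/eq_in_map => B; rewrite mem_sorted_blocks => /ne/last_positions.
  (* Sorting gives weakly increasing maxima; disjoint blocks cannot share one, so the order is
     strict. *)
  rewrite ltn_sorted_uniq_leq; apply/andP; split; last first.
    by rewrite sorted_map; apply: sort_sorted => B C; apply: leq_total.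
  rewrite map_inj_in_uniq ?sort_uniq ?enum_uniq // => B C.
  rewrite !mem_sorted_blocks => BP CP; rewrite -!last_positions ?ne // => E.
  have /last_mem_ne/mapP[i] : ~~ nilp (positions B) by rewrite nilp_positions ne.
  rewrite mem_enum => iB Ei.
  have : last 0%N (positions C) \in positions C.
    by apply: last_mem_ne; rewrite nilp_positions ne.
  rewrite -E Ei mem_positions => iC.
  by rewrite -(def_pblock trP BP iB) (def_pblock trP CP iC).
Qed.

Lemma ordered_partition_blocks Q : ordered_partition (iota 0 n) Q ->
  exists2 P, partition P [set: 'I_n] & blocks P = Q.
Proof.
move=> opQ; have /and3P[Qp Qne Qlt] := opQ.
pose ob (b : seq nat) := [set i : 'I_n | val i \in b].
have Qn b j : b \in Q -> j \in b -> (j < n)%N.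
  move=> bQ jb; have : j \in flatten Q by apply/flattenP; exists b.
  by rewrite (perm_mem Qp) mem_iota.
have obK b : b \in Q -> positions (ob b) = b.
  move=> bQ; apply: (irr_sorted_eq ltn_trans ltnn); first exact: positions_sorted.
    by have /andP[] := allP Qne b bQ.
  move=> j; apply/idP/idP => [/mapP[i + ->]|jb]; first by rewrite mem_enum inE.
  by rewrite -[j]/(val (Ordinal (Qn b j bQ jb))) mem_positions inE.
have Qu : uniq (flatten Q) by rewrite (perm_uniq Qp) iota_uniq.
pose P := [set B in [seq ob b | b <- Q]].
have partP : partition P [set: 'I_n].
  apply/and3P; split.
  - rewrite eqEsubset subsetT; apply/subsetP => i _.
    have /flattenP[b bQ ib] : val i \in flatten Q.
      by rewrite (perm_mem Qp) mem_iota /=.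
    by apply/bigcupP; exists (ob b); rewrite inE // map_f.
  - apply/trivIsetP => B C; rewrite !inE => /mapP[b bQ ->] /mapP[c cQ ->].
    apply: contraR => /pred0Pn[i /andP[/=]]; rewrite !inE => ib ic.
    by rewrite (flatten_uniq_inj Qu bQ cQ ib ic).
  - rewrite inE; apply/mapP => -[b bQ b0].
    by have /andP[] := allP Qne b bQ; rewrite -(obK b bQ) -b0 nilp_positions eqxx.
exists P => //; have /and3P[_ _ Plt] := blocks_ordered_partition partP.
(* Both lists are strictly sorted by last element, so equal membership forces equality. *)
apply: (@irr_sorted_eq _ (relpre (last 0%N) ltn)).
- by move=> b c d; apply: ltn_trans.
- by move=> b; apply: ltnn.
- by rewrite -sorted_map.
- by rewrite -sorted_map.
move=> b; apply/mapP/idP => [[B] | bQ].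
  by rewrite mem_sorted_blocks inE => /mapP[c cQ ->] ->; rewrite obK.
by exists (ob b); rewrite ?obK // mem_sorted_blocks inE map_f.
Qed.

Lemma sum_partitions (M : zmodType) (G : seq (seq nat) -> M) :
  \sum_(P : {set {set 'I_n}} | partition P [set: 'I_n]) G (blocks P) =
  \sum_(Q <- parts (iota 0 n)) G Q.
Proof.
transitivity (\sum_(Q <- [seq blocks P | P <- enum (partition^~ [set: 'I_n])]) G Q).
  by rewrite big_map big_enum.
apply/perm_big/uniq_perm.
- by rewrite (map_inj_uniq blocks_inj) enum_uniq.
- exact/parts_uniq/iota_ltn_sorted.
move=> Q; rewrite parts_ordered_partition ?iota_ltn_sorted //.
apply/mapP/idP => [[P] | /ordered_partition_blocks[P PP <-]].
  by rewrite mem_enum => PP ->; apply: blocks_ordered_partition.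
by exists P; rewrite ?mem_enum.
Qed.

End SortedBlocks.

(** * The K-map *)

Lemma prod_opp (k : fieldType) (T : algType k) (I : Type) (s : seq I) (F : I -> T) :
  \prod_(i <- s) - F i = (-1) ^+ size s *: \prod_(i <- s) F i.
Proof.
elim: s => [|i s IH] /=; first by rewrite !big_nil scale1r.
by rewrite !big_cons IH exprS mulN1r scaleNr mulNr -scalerAr.
Qed.

Section KMap.
Context (k : fieldType) (V : lmodType k) (T : algType k).
Variables (letter : {linear V -> T}) (tri : {bilinear V -> V -> V}).
Variables (ext black : {bilinear T -> T -> T}) (K : {linear T -> T}).
Hypothesis ext_letter2 : forall x a, ext (letter x) (letter a) = letter (tri x a).
Hypothesis black0 : forall a, black 1 (letter a) = letter a.
Hypothesis blackS : forall x X a,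
  black (word letter (x :: X)) (letter a) =
  black (word letter X) (letter (tri x a))
  + \sum_(Z <- acts (tri x) X) black (word letter Z) (letter a).
Local Notation W := (word letter).

(** Both sides satisfy the same recursion. Brackets are formed in T, where [ext] restricts to [tri]
    on letters. *)
Lemma black_bracket X a :
  black (W X) (letter a) = bracket_sum ext (map letter X) (letter a).
Proof.
have [n] := ubnP (size X); elim: n X a => // n IH [|x X] a /ltnSE leXn.
  by rewrite word_nil black0 bracket_sum_nil.
rewrite blackS bracket_sum_cons ext_letter2 IH // (acts_map (f := tri x)) //.
rewrite big_map; congr (_ + _); apply: eq_big_seq => Z ZX; apply: IH.
by rewrite (eqP (allP (all_size_acts _ _) _ ZX)).
Qed.

Definition block_black (B : seq V) : T :=
  black (W (take (size B).-1 B)) (letter (last 0 B)).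

Lemma block_black_rcons X a : block_black (rcons X a) = black (W X) (letter a).
Proof. by rewrite /block_black size_rcons last_rcons -cats1 take_size_cat. Qed.

(** The two kinds of terms in the [black] recursion, x acting on the last letter or on an earlier
    one, combine into one sum over all letters of the block. *)
Lemma block_black_cons x B : ~~ nilp B ->
  block_black (x :: B) = \sum_(Z <- acts (tri x) B) block_black Z.
Proof.
case/lastP: B => // B a _; rewrite -rcons_cons block_black_rcons blackS.
rewrite big_acts_rcons block_black_rcons addrC; congr (_ + _).
by apply: eq_bigr => Z _; rewrite block_black_rcons.
Qed.

Lemma block_black_insert x P : all (fun B => ~~ nilp B) P ->
  \sum_(Q <- acts (cons x) P) \prod_(B <- Q) - block_black B =
  \sum_(Q <- deep_acts (tri x) P) \prod_(B <- Q) - block_black B.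
Proof.
elim: P => [|B P IH] /=; first by rewrite !big_nil.
case/andP=> Bne Pne; rewrite big_acts_cons big_deep_acts_cons big_cons.
rewrite block_black_cons // -sumrN mulr_suml; congr (_ + _).
  by apply: eq_bigr => C _; rewrite big_cons.
under eq_bigr => Q _ do rewrite big_cons.
under [RHS]eq_bigr => Q _ do rewrite big_cons.
by rewrite -!mulr_sumr IH.
Qed.

Lemma parts_nonempty (A : eqType) (X : seq A) P :
  P \in parts X -> all (fun B => ~~ nilp B) P.
Proof.
elim: X P => [|x X IH] P /=; first by rewrite inE => /eqP->.
case/flattenP=> _ /mapP[Q /IH Qne ->]; rewrite inE => /orP[/eqP->|] //=.
case/mem_actsP=> P1 [B [P2 [EQ ->]]]; move: Qne.
by rewrite EQ !all_cat /= => /and3P[-> _ ->].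
Qed.

Hypothesis hK : is_Kmap letter tri K.

(** The sign is distributed as (-1)^n times one minus sign per block, which makes the summand
    multiplicative over blocks. A singleton block of x gives the term x K(X), larger blocks give the
    subtracted sum. *)
Lemma Kmap_parts X :
  K (W X) = (-1) ^+ size X *: \sum_(P <- parts X) \prod_(B <- P) - block_black B.
Proof.
have [K1 _ KS] := hK.
have [n] := ubnP (size X); elim: n X => // n IH [|x X] /ltnSE leXn.
  by rewrite word_nil K1 /= big_seq1 big_nil scale1r.
rewrite KS (sum_set_nth (tri x) 0 X (fun Z => K (W Z))) IH //.
rewrite big_parts_cons big_split exprS -scalerA scaleN1r -scalerN opprD.
rewrite scalerDr; congr (_ + _).
  rewrite -scalerAr mulr_sumr -sumrN; congr (_ *: _); apply: eq_bigr => P _.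
  rewrite big_cons (block_black_rcons [::] x) word_nil black0.
  by rewrite mulNr opprK.
rewrite scalerN; congr (- _).
transitivity (\sum_(Z <- acts (tri x) X) (-1) ^+ size X *:
    \sum_(P <- parts Z) \prod_(B <- P) - block_black B).
  apply: eq_big_seq => Z /(allP (all_size_acts _ _))/eqP sZ.
  by rewrite IH sZ.
rewrite -scaler_sumr acts_parts; congr (_ *: _); apply: eq_big_seq => P PX.
exact/esym/block_black_insert/(parts_nonempty PX).
Qed.

End KMap.

Theorem proposition3p2 (k : closedFieldType) (char0 : [pchar k] =i pred0)
  (V : lmodType k) (tri : {bilinear V -> V -> V})
  (T : algType k) (letter : {linear V -> T})
  (hT : is_tensor_algebra letter)
  (TT : algType k) (tens : {bilinear T -> T -> TT})
  (hTT : is_tensor_square_algebra tens)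
  (Delta : {lrmorphism T -> TT}) (hDelta : is_coshuffle letter tens Delta)
  (eps : {scalar T}) (heps : is_counit tens Delta eps)
  (ext : {bilinear T -> T -> T})
  (hext : is_extension letter tens Delta eps tri ext)
  (S : {linear T -> T}) (hS : is_antipode tens Delta eps ext S)
  (black : {bilinear T -> T -> T}) (hblack : is_black letter ext S black)
  (K : {linear T -> T}) (hK : is_Kmap letter tri K)
  (n : nat) (x : 'I_n -> V) :
  (forall I : {set 'I_n}, I != set0 ->
     xblack letter black x I =
       \sum_(w : 'S_(size (map letter (init_letters x I))))
         bracket ext (letter (last_letter x I)) w
     /\ exists v : V, xblack letter black x I = letter v) /\
  (forall i : 'I_n, xblack letter black x [set i] = letter (x i)) /\
  K (word letter [seq x i | i <- enum 'I_n]) =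
    \sum_(P : {set {set 'I_n}} | partition P [set: 'I_n])
      (-1) ^+ (n - #|P|)
        *: \prod_(B <- sorted_blocks P) xblack letter black x B.
Proof.
have b0 := black_nil hT hTT hDelta heps hext hS hblack.
have bS := black_cons hT hTT hDelta heps hext hS hblack.
have [e1 _ _ _ _] := hext.
split=> [I _|]; last split=> [i|].
- split; first exact: (black_bracket e1 b0 bS).
  exact: (black_letter hT hTT hDelta heps hext hS hblack).
- by rewrite /xblack /init_letters /last_letter /letters enum_set1 cards1 /= word_nil b0.
pose xs := [seq x i | i <- enum 'I_n].
have xsE (i : 'I_n) : nth 0 xs (val i) = x i.
  by rewrite (nth_map i) ?nth_ord_enum // size_enum_ord; apply: ltn_ord.
have xblackE B : xblack letter black x B =
    block_black letter black [seq nth 0 xs j | j <- positions B].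
  have -> : [seq nth 0 xs j | j <- positions B] = letters x B.
    by rewrite /positions -map_comp; apply: eq_map => i; apply: xsE.
  by rewrite /block_black /xblack /init_letters /last_letter size_map -cardE.
have Exs : xs = [seq nth 0 xs j | j <- iota 0 n].
  by rewrite -val_enum_ord -map_comp; apply: eq_map => i; rewrite /= xsE.
rewrite (Kmap_parts b0 bS hK) size_map size_enum_ord -/xs Exs parts_map big_map.
rewrite -(sum_partitions n (fun Q => \prod_(B <- [seq [seq nth 0 xs a | a <- C] | C <- Q])
  - block_black letter black B)) scaler_sumr.
apply: eq_bigr => P partP.
(* Blocks are nonempty, so the truncated subtraction in the exponent is a true difference. *)
have leP : (#|P| <= n)%N.
  rewrite -[n in (_ <= n)%N]card_ord -cardsT (card_partition partP) -sum1_card.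
  apply: leq_sum => B BP; rewrite card_gt0.
  by have /and3P[_ _ P0] := partP; apply: contraNneq P0 => <-.
rewrite !big_map.
under eq_bigr => B _ do rewrite -xblackE.
(* Splitting n as (n - |P|) + |P|, the block signs square to 1. *)
rewrite prod_opp size_sort -cardE scalerA -{1}(subnK leP) exprD -mulrA -expr2.
by rewrite sqrr_sign mulr1.
Qed.
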